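(* Consider the problem \[ (\mathcal{P}) \quad \text{minimize } f_0(x) = g_0(x) - h_0(x) \quad \text{subject to } F(x) = G(x) - H(x) \preceq_K 0, \quad x \in Q. \] Let the function $f_0$ be bounded below on the feasible region of $(\mathcal{P})$, and let $\{x_n\}$ be the sequence generated by the DCA for cone constrained problems (described in the context). Then the following statements hold true: 1. The feasible region $\Omega(x_n)$ of the convex subproblem on Step 2 is nonempty for all $n \in \mathbb{N}$, and the sequence $\{x_n\}$ is feasible for $(\mathcal{P})$. 2. For any $n \in \mathbb{N}$ either $x_n$ is a critical point of $(\mathcal{P})$ and the process terminates at step $n$, or $f_0(x_{n+1}) < f_0(x_n)$; moreover, if the method does not terminate, then the sequence $\{f_0(x_n)\}$ converges. 3. If the function $h_0$ is strongly convex with constant $\mu > 0$, then \[ f_0(x_{n+1}) \le f_0(x_n) - \frac{\mu}{2} |x_{n+1} - x_n|^2 \] for all $n \in \mathbb{N}$. 4. If $x_*$ is a limit point of the sequence $\{x_n\}$ such that \[ 0 \in \operatorname{int}\big\{ G(x) - H(x_* ) - D H(x_* )(x - x_* ) + K \bigm| x \in Q \big\}, \] then $x_*$ is a critical point for $(\mathcal{P})$.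
   Context: $g_0, h_0 \colon \mathbb{R}^d \to \mathbb{R}$ are real-valued closed convex functions; $\partial$ denotes the subdifferential in the sense of convex analysis. $Y$ is a real Banach space, $K \subset Y$ is a proper cone (a closed convex cone with $K \cap (-K) = \{0\}$), $x \preceq_K y$ iff $y - x \in K$. The maps $G, H \colon \mathbb{R}^d \to Y$ are $K$-convex ($G(\alpha x_1 + (1-\alpha)x_2) \preceq_K \alpha G(x_1) + (1-\alpha) G(x_2)$ for all $\alpha \in [0,1]$, $x_1, x_2\in\mathbb{R}^d$, and similarly for $H$), $H$ is continuously Fréchet differentiable with derivative $DH$, and $Q \subseteq \mathbb{R}^d$ is a closed convex set. Put $\Omega(z) = \{ x \in Q \mid G(x) - H(z) - D H(z)(x - z) \preceq_K 0 \}$ and, for a convex set $V$ and $x \in V$, $N_V(x) = \{ v \mid \langle v, z - x \rangle \le 0 \ \forall z \in V \}$. A point $x_*$ (feasible for $(\mathcal{P})$) is critical for $(\mathcal{P})$ if $\partial h_0(x_* ) \cap ( \partial g_0(x_* ) + N_{\Omega(x_* )}(x_* ) ) \ne \emptyset$; equivalently, there is $v \in \partial h_0(x_* )$ such that $x_*$ is a globally optimal solution of: minimize $g_0(x) - h_0(x_* ) - \langle v, x - x_* \rangle$ over $x \in \Omega(x_* )$. DCA for cone constrained problems. Initialization: choose a feasible point $x_0$ of $(\mathcal{P})$, set $n = 0$. Step 1: compute some $v_n \in \partial h_0(x_n)$ and $D H(x_n)$. Step 2: let $x_{n+1}$ be an optimal solution of the convex problem: minimize $g_0(x) - \langle v_n,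 x \rangle$ subject to $G(x) - H(x_n) - D H(x_n)(x - x_n) \preceq_K 0$, $x \in Q$ (i.e. $x \in \Omega(x_n)$). If a stopping criterion is met, stop; otherwise set $n := n+1$ and go to Step 1. It is assumed that the iterations are well defined (the subproblems have optimal solutions). The stopping criterion is satisfied if $x_{n+1} = x_n$, i.e. the method terminates if it fails to improve the current iterate $x_n$, that is, if $x_n$ is itself an optimal solution of the subproblem of Step 2. *)

(* Defs.v *)
From mathcomp Require Import all_boot all_order all_algebra.
From mathcomp Require Import all_classical all_reals all_analysis.

Set Implicit Arguments.
Unset Strict Implicit.
Unset Printing Implicit Defensive.
Import Order.TTheory GRing.Theory Num.Theory.
Import numFieldNormedType.Exports.
Local Open Scope classical_set_scope.
Local Open Scope ring_scope.

(* Points of R^d, and the (sub)gradients acting on them, are row vectors.  The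
   norm [`|x|] that the library puts on ['rV[R]_d] is the max norm: it is used
   below only for notions that are the same for all equivalent norms.  The
   Euclidean norm is [enorm]. *)
Section EuclideanSpace.
Context {R : realType} {d : nat}.
Implicit Types (x y v : 'rV[R]_d) (f : 'rV[R]_d -> R) (V : set 'rV[R]_d).

Definition dotv x y : R := \sum_(i < d) x 0 i * y 0 i.

Definition enorm x : R := Num.sqrt (dotv x x).

(* The second conjunct says that the epigraph of [f] is closed. *)
Definition closed_convex_function f : Prop :=
  convex_function setT f /\ closed [set p : 'rV[R]_d * R | f p.1 <= p.2].

Definition strongly_convex (mu : R) f : Prop :=
  forall x y (a : R), 0 <= a <= 1 ->
    f (a *: x + (1 - a) *: y) <=
      a * f x + (1 - a) * f y
      - mu / 2 * a * (1 - a) * enorm (x - y) ^+ 2.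

Definition subdifferential f x : set 'rV[R]_d :=
  [set v | forall y, f x + dotv v (y - x) <= f y].

Definition normal_cone V x : set 'rV[R]_d :=
  [set v | forall z, V z -> dotv v (z - x) <= 0].

End EuclideanSpace.

Section ConeOrder.
Context {R : realType} {Y : normedModType R}.
Implicit Types (K : set Y) (y z : Y).

Definition proper_cone K : Prop :=
  [/\ closed K,
      convex_set K,
      forall (t : R) y, 0 <= t -> K y -> K (t *: y)
    & K `&` [set - y | y in K] = [set 0]].

Definition cone_le K y z : Prop := K (z - y).

Definition cone_convex {d : nat} K (F : 'rV[R]_d -> Y) : Prop :=
  forall (a : R) x1 x2, 0 <= a <= 1 ->
    cone_le K (F (a *: x1 + (1 - a) *: x2)) (a *: F x1 + (1 - a) *: F x2).

(* Continuity of the derivative is continuity in the operator norm. *)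
Definition continuously_differentiable {d : nat} (F : 'rV[R]_d -> Y) : Prop :=
  (forall x, differentiable F x) /\
  (forall x (e : R), 0 < e ->
     \forall z \near x, forall u, `|'d F z u - 'd F x u| <= e * `|u|).

End ConeOrder.

(* The problem: minimize g0 x - h0 x subject to G x - H x <=_K 0 and x in Q. *)
Section DCProblem.
Context {R : realType} {d : nat} {Y : normedModType R}.
Variables (g0 h0 : 'rV[R]_d -> R) (K : set Y) (G H : 'rV[R]_d -> Y)
  (Q : set 'rV[R]_d).

Definition feasible : set 'rV[R]_d :=
  [set x | cone_le K (G x - H x) 0 /\ Q x].

Definition Omega (z : 'rV[R]_d) : set 'rV[R]_d :=
  [set x | Q x /\ cone_le K (G x - H z - 'd H z (x - z)) 0].

Definition critical (x : 'rV[R]_d) : Prop :=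
  feasible x /\
  subdifferential h0 x `&`
    [set a + b | a in subdifferential g0 x & b in normal_cone (Omega x) x]
  !=set0.

Definition subproblem_solution (v z y : 'rV[R]_d) : Prop :=
  Omega z y /\
  forall x, Omega z x -> g0 y - dotv v y <= g0 x - dotv v x.

(* A run of the method is given by the sequences of its iterates [x n] and
   subgradients [v n].  A terminating run is finite: if the method terminates
   at step N, only x 0, .., x N.+1 and v 0, .., v N belong to the run, and the
   values of [x] and [v] at larger indices are unconstrained. *)
Section Run.
Variables x v : nat -> 'rV[R]_d.

(* The current iterate already solves the subproblem; in a run, x n.+1 = x n
   is a particular case, since x n.+1 solves that subproblem. *)
Definition stopping_criterion (n : nat) : Prop :=
  subproblem_solution (v n) (x n) (x n).

Definition step_performed (n : nat) : Prop :=
  forall m, (m < n)%N -> ~ stopping_criterion m.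

Definition terminates_at (n : nat) : Prop :=
  step_performed n /\ stopping_criterion n.

(* x 0 is always generated (0.-1 = 0); x n.+1 is generated by step n. *)
Definition generated (n : nat) : Prop := step_performed n.-1.

Definition dca_run : Prop :=
  feasible (x 0%N) /\
  forall n, step_performed n ->
    subdifferential h0 (x n) (v n) /\
    subproblem_solution (v n) (x n) (x n.+1).

End Run.
End DCProblem.

(* Main.v *)
(* Everything but the last statement follows from two subgradient inequalities:
   the one for h0, which turns a decrease of the subproblem into a decrease of
   g0 - h0, and the one for the K-convex map H, which shows that the linearized
   constraint is stronger than the original one.  An optimal solution of a
   subproblem is critical by the sum rule for subdifferentials, that is, by a
   finite-dimensional Hahn-Banach argument.

   For the last statement, the subgradients v n are bounded near a limit point
   xs, so that (x n, v n) has a cluster point (xs, vs).  Robinson's condition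
   makes the set Omega lower semicontinuous at xs: each point y of Omega xs is
   approximated by points of Omega (x n), which the subproblems compare with
   x n.+1.  As g0 - h0 decreases along the run, in the limit y cannot improve
   on xs in the subproblem defined by xs and vs.

   The map G need not be continuous when the cone K is not normal, but a
   K-convex map on R^d is bounded above and below by small perturbations of its
   value at a point (Jensen's inequality on the points x + e_i and x - e_i), and
   this suffices for the closedness of its K-epigraph. *)
Require Import Defs.
From mathcomp Require Import all_boot all_order all_algebra ring lra.
From mathcomp Require Import all_classical all_reals all_analysis.
Import Order.TTheory GRing.Theory Num.Theory.
Import numFieldNormedType.Exports.
Local Open Scope classical_set_scope.
Local Open Scope ring_scope.

Set Implicit Arguments.
Unset Strict Implicit.
Unset Printing Implicit Defensive.

(** * Convex combinations and the order defined by a proper cone *)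

Section Convexity.
Context {R : realType}.

Lemma convex_set_segment (E : lmodType R) (A : set E) (a : R) x y :
  convex_set A -> 0 <= a <= 1 -> A x -> A y -> A (a *: x + (1 - a) *: y).
Proof.
move=> Acvx /andP[a0 a1] Ax Ay.
have := Acvx x y (Itv01 a0 a1).
by rewrite !inE; exact.
Qed.

Lemma convex_function_segment (E : lmodType R) (f : E -> R) (a : R) x y :
  convex_function setT f -> 0 <= a <= 1 ->
  f (a *: x + (1 - a) *: y) <= a * f x + (1 - a) * f y.
Proof.
move=> fcvx /andP[a0 a1].
by have := fcvx (Itv01 a0 a1) x y; rewrite !inE; exact.
Qed.

End Convexity.

Section ProperCone.
Context {R : realType} {Y : normedModType R} (K : set Y).
Hypothesis K_proper : proper_cone K.
Implicit Types (y z u w : Y).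

Lemma proper_cone0 : K 0.
Proof.
case: K_proper => _ _ _ K0.
by have [] : (K `&` [set - y | y in K]) 0 by rewrite K0.
Qed.

Lemma proper_coneZ (t : R) y : 0 <= t -> K y -> K (t *: y).
Proof. by case: K_proper => _ _ KZ _; exact: KZ. Qed.

Lemma proper_coneD y z : K y -> K z -> K (y + z).
Proof.
case: K_proper => _ Kcvx KZ _ Ky Kz.
have -> : y + z = 2 *: (2^-1 *: y + (1 - 2^-1) *: z).
  rewrite scalerDr !scalerA mulrBr mulfV// mulr1.
  by rewrite (_ : 2 - 1 = 1) ?scale1r//; lra.
by apply: KZ => //; apply: convex_set_segment => //; lra.
Qed.

Lemma cone_lexx y : cone_le K y y.
Proof. by rewrite /cone_le subrr; exact: proper_cone0. Qed.

Lemma cone_le_trans z y u : cone_le K y z -> cone_le K z u -> cone_le K y u.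
Proof.
by move=> yz zu; rewrite /cone_le -(subrKA z); exact: proper_coneD.
Qed.

Lemma cone_leD y z u w :
  cone_le K y z -> cone_le K u w -> cone_le K (y + u) (z + w).
Proof. by move=> yz uw; rewrite /cone_le opprD addrACA; exact: proper_coneD. Qed.

Lemma cone_leZ (t : R) y z :
  0 <= t -> cone_le K y z -> cone_le K (t *: y) (t *: z).
Proof. by move=> t0 yz; rewrite /cone_le -scalerBr; exact: proper_coneZ. Qed.

Context {d : nat} (F : 'rV[R]_d -> Y).
Hypothesis F_cvx : cone_convex K F.

(** Jensen's inequality in which [x] carries the remaining weight [1 - \sum_i l i]. The induction
    splits off the last point, of weight [m]; since the sum is strictly below 1, the other weights
    can be divided by [1 - m] and their sum stays below 1. *)
Lemma cone_convex_jensen n (x : 'rV[R]_d) (w : 'I_n -> 'rV[R]_d) (l : 'I_n -> R) :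
  (forall i, 0 <= l i) -> \sum_i l i < 1 ->
  cone_le K (F (x + \sum_i l i *: w i))
    (F x + \sum_i l i *: (F (x + w i) - F x)).
Proof.
elim: n => [|n IHn] in w l *.
  by rewrite !big_ord0 !addr0 => _ _; exact: cone_lexx.
move=> l0; rewrite !big_ord_recr/=.
set m := l ord_max; set j := widen_ord _ => lm1.
have s0 : 0 <= \sum_(i < n) l (j i) by apply: sumr_ge0.
have m0 : 0 <= m by exact: l0.
have m1 : 0 < 1 - m by lra.
have lV i : l (j i) = (1 - m) * (l (j i) / (1 - m)).
  by rewrite mulrC divfK// gt_eqF.
have -> : x + (\sum_(i < n) l (j i) *: w (j i) + m *: w ord_max) =
    m *: (x + w ord_max) +
    (1 - m) *: (x + \sum_(i < n) (l (j i) / (1 - m)) *: w (j i)).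
  rewrite !scalerDr scaler_sumr.
  under [in RHS]eq_bigr do rewrite scalerA -lV.
  by rewrite addrACA -scalerDl subrKC scale1r [m *: _ + _]addrC.
apply: cone_le_trans (F_cvx _ _ _) _; first lra.
have -> : F x + (\sum_(i < n) l (j i) *: (F (x + w (j i)) - F x) +
    m *: (F (x + w ord_max) - F x)) = m *: F (x + w ord_max) +
    (1 - m) *: (F x + \sum_(i < n) (l (j i) / (1 - m)) *: (F (x + w (j i)) - F x)).
  rewrite !scalerDr scaler_sumr.
  under [in RHS]eq_bigr do rewrite scalerA -lV.
  rewrite scalerBl scale1r scalerN.
  by rewrite !addrA [LHS](ACl (3*1*4*2)).
apply: cone_leD; first exact: cone_lexx.
apply: cone_leZ; first exact: ltW.
apply: IHn => [i|]; first by rewrite divr_ge0// ltW.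
by rewrite -mulr_suml ltr_pdivrMr// mul1r; lra.
Qed.

End ProperCone.

(** * K-convex maps and convex functions near a point *)

Lemma closed_normP {R : realType} {V : normedModType R} (A : set V) :
  closed A <->
  forall y, (forall e : R, 0 < e -> exists2 z, A z & `|y - z| < e) -> A y.
Proof.
split=> [Acl y Ay|Acl y Ay].
  apply: Acl => B /nbhs_ballP[e /= e0 yeB].
  have [z Az yz] := Ay _ e0.
  by exists z; split => //; apply: yeB; rewrite -ball_normE.
apply: Acl => e e0.
have [z [Az]] := Ay _ (nbhsx_ballx y e e0).
by rewrite -ball_normE; exists z.
Qed.

Lemma near_normP {R : realType} {V : normedModType R} (x : V) (P : set V) :
  (\forall y \near x, P y) <->
  exists2 r : R, 0 < r & forall y, `|x - y| < r -> P y.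
Proof.
split=> [/nbhs_ballP[r r0 xrP]|[r r0 xrP]].
  by exists r => // y xy; apply: xrP; rewrite -ball_normE.
by apply/nbhs_ballP; exists r => // y; rewrite -ball_normE; exact: xrP.
Qed.

Lemma continuous_normP {R : realType} {V W : normedModType R} (f : V -> W) x :
  {for x, continuous f} <->
  forall e : R, 0 < e -> \forall y \near x, `|f x - f y| < e.
Proof. by split=> /cvgrPdist_lt. Qed.

Lemma continuous_graph {R : realType} {V W : normedModType R} (f : V -> W) x :
  {for x, continuous f} -> {for x, continuous (fun y => (y, f y))}.
Proof. by move=> fx; apply: cvg_pair; first exact: cvg_id. Qed.

Lemma le_coord_norm {R : realType} {d : nat} (u : 'rV[R]_d) i : `|u 0 i| <= `|u|.
Proof.
rewrite [leRHS]/Num.norm/= mx_normrE; apply/bigmax_geP; right => /=.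
by exists (ord0, i).
Qed.

Section Dot.
Context {R : realType} {d : nat}.
Implicit Types x y z : 'rV[R]_d.

Lemma dotvC x y : dotv x y = dotv y x.
Proof. by apply: eq_bigr => i _; rewrite mulrC. Qed.

Lemma dotvDr x y z : dotv x (y + z) = dotv x y + dotv x z.
Proof.
by rewrite /dotv -big_split; apply: eq_bigr => i _ /=; rewrite mxE mulrDr.
Qed.

Lemma dotvZr x y (a : R) : dotv x (a *: y) = a * dotv x y.
Proof.
by rewrite /dotv mulr_sumr; apply: eq_bigr => i _; rewrite mxE mulrCA.
Qed.

Lemma dotvNr x y : dotv x (- y) = - dotv x y.
Proof. by rewrite -scaleN1r dotvZr mulN1r. Qed.

Lemma dotvBr x y z : dotv x (y - z) = dotv x y - dotv x z.
Proof. by rewrite dotvDr dotvNr. Qed.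

Lemma dotvDl x y z : dotv (x + y) z = dotv x z + dotv y z.
Proof. by rewrite dotvC dotvDr !(dotvC z). Qed.

Lemma dotvNl x y : dotv (- x) y = - dotv x y.
Proof. by rewrite dotvC dotvNr dotvC. Qed.

Lemma dotv0r x : dotv x 0 = 0.
Proof. by rewrite -(scale0r x) dotvZr mul0r. Qed.

Lemma dotv_deltar x i : dotv x (delta_mx 0 i) = x 0 i.
Proof.
rewrite /dotv (bigD1 i)//= big1 => [|j ji].
  by rewrite !mxE !eqxx mulr1 addr0.
by rewrite !mxE (negbTE ji) andbF mulr0.
Qed.

Lemma dotv_le x y : `|dotv x y| <= d%:R * `|x| * `|y|.
Proof.
apply: le_trans (ler_norm_sum _ _ _) _.
have -> : d%:R * `|x| * `|y| = \sum_(i < d) `|x| * `|y|.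
  by rewrite sumr_const card_ord mulr_natl mulrnAl.
by apply: ler_sum => i _; rewrite normrM ler_pM// le_coord_norm.
Qed.

End Dot.

Section ConeConvexLocal.
Context {R : realType} {Y : normedModType R} (K : set Y).
Hypothesis K_proper : proper_cone K.
Context {d : nat} (F : 'rV[R]_d -> Y).
Hypothesis F_cvx : cone_convex K F.

(** The vector [u] is a combination of the signed basis vectors [w i] with weights [|u 0 i|], whose
    sum is below 1 by the bound on [u] in the max norm. Jensen's inequality then gives an error
    linear in [|u|]. *)
Lemma cone_convex_upper (x : 'rV[R]_d) : exists2 C : R, 0 <= C &
  forall u, `|u| * d%:R < 1 ->
    exists2 b, `|b| <= C * `|u| & cone_le K (F (x + u)) (F x + b).
Proof.
pose e i : 'rV[R]_d := delta_mx 0 i.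
pose c i := `|F (x + e i) - F x| + `|F (x - e i) - F x|.
exists (\sum_i c i); first by apply: sumr_ge0 => i _; rewrite addr_ge0.
move=> u u1; pose w i := if 0 <= u 0 i then e i else - e i.
exists (\sum_i `|u 0 i| *: (F (x + w i) - F x)).
  rewrite mulr_suml; apply: le_trans (ler_norm_sum _ _ _) _.
  apply: ler_sum => i _; rewrite normrZ normr_id mulrC.
  apply: ler_pM => //; last exact: le_coord_norm.
  by rewrite /w; case: ifP => _; rewrite ?lerDl ?lerDr.
have {1}-> : u = \sum_i `|u 0 i| *: w i.
  rewrite {1}[u]row_sum_delta; apply: eq_bigr => i _; rewrite /w.
  case: lerP => ui; first by rewrite ger0_norm.
  by rewrite ltr0_norm// scalerN scaleNr opprK.
apply: cone_convex_jensen => //; apply: le_lt_trans u1.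
have -> : `|u| * d%:R = \sum_(i < d) `|u|.
  by rewrite sumr_const card_ord mulr_natr.
by apply: ler_sum => i _; exact: le_coord_norm.
Qed.

(** As [x] is the midpoint of [x + u] and [x - u], the upper bound at [x - u] turns into a lower
    bound at [x + u]. *)
Lemma cone_convex_lower (x : 'rV[R]_d) : exists2 C : R, 0 <= C &
  forall u, `|u| * d%:R < 1 ->
    exists2 b, `|b| <= C * `|u| & cone_le K (F x) (F (x + u) + b).
Proof.
have [C C0 FC] := cone_convex_upper x; exists C => // u u1.
have [|b bC Fb] := FC (- u); first by rewrite normrN.
exists b; first by rewrite -(normrN u).
have h : 0 <= (2^-1 : R) <= 1 by lra.
have := F_cvx (x + u) (x - u) h.
have -> : 1 - 2^-1 = 2^-1 :> R by lra.
have -> : 2^-1 *: (x + u) + 2^-1 *: (x - u) = x.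
  rewrite -scalerDr addrACA subrr addr0 scalerDr -scalerDl.
  by rewrite (_ : 2^-1 + 2^-1 = 1) ?scale1r//; lra.
rewrite -scalerDr => /(cone_leZ K_proper (ler0n R 2)).
rewrite scalerA mulfV// scale1r => Fx.
have {}Fx : cone_le K (2 *: F x) (F x + (F (x + u) + b)).
  apply: cone_le_trans Fx _ => //; rewrite addrCA.
  by apply: cone_leD => //; exact: cone_lexx.
move: Fx; rewrite /cone_le scaler_nat mulr2n opprD addrACA subrr add0r.
by rewrite addrC.
Qed.

(** For [(x', y')] in the epigraph close to [(x, y)], the lower bound gives [F x] below [F x' + b],
    hence below [y' + b], with [b] small; closedness of [K] concludes. *)
Lemma closed_cone_epigraph :
  closed [set p : 'rV[R]_d * Y | cone_le K (F p.1) p.2].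
Proof.
apply/closed_normP => -[x y] /= approx.
have [C C0 FC] := cone_convex_lower x.
have Kcl : closed K by case: K_proper.
apply: (closed_normP K).1 => // e e0.
(* The first bound makes the total error [|y - y'| + C * |x - x'|] less than [e]; the second makes
   the lower bound applicable to [x' - x]. *)
pose dl := Num.min (e / (1 + C)) ((d%:R + 1)^-1).
have C1 : 0 < 1 + C by lra.
have d1 : 0 < d%:R + 1 :> R by rewrite ltr_wpDl.
have dl0 : 0 < dl by rewrite lt_min divr_gt0// invr_gt0.
have [[x' y'] /= Fx'y'] := approx _ dl0.
rewrite prod_normE/= gt_max lt_min => /andP[/andP[xx1 xx2]].
rewrite lt_min => /andP[yy _].
have [|b bC Fb] := FC (x' - x).
  rewrite distrC; apply: (@le_lt_trans _ _ ((d%:R + 1)^-1 * d%:R)).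
    by rewrite ler_wpM2r// ltW.
  by rewrite mulrC ltr_pdivrMr ?mul1r ?ltrDl.
rewrite subrKC in Fb.
exists (y' + b - F x).
  apply: cone_le_trans Fb _ => //; apply: cone_leD => //; exact: cone_lexx.
rewrite opprB addrA subrK opprD addrA.
apply: le_lt_trans (ler_normB _ _) _.
rewrite distrC in bC.
have : C * `|x - x'| <= C * (e / (1 + C)) by rewrite ler_wpM2l// ltW.
have -> : C * (e / (1 + C)) = e - e / (1 + C) by field; rewrite gt_eqF.
by lra.
Qed.

End ConeConvexLocal.

(** With this cone in the real line, convex functions are K-convex maps and inherit the two local
    bounds. *)
Lemma proper_cone_ge0 {R : realType} : proper_cone [set r : R^o | 0 <= r].
Proof.
split.
- exact: closed_ge.
- move=> x y l; rewrite !inE /= => x0 y0.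
  by change (0 <= l%:num * x + (1 - l%:num) * y); rewrite addr_ge0// mulr_ge0// subr_ge0.
- by move=> t y t0 /= y0; exact: mulr_ge0.
- apply/seteqP; split=> [y [/= y0 [z /= z0 zy]]|y ->/=].
    by apply/eqP; rewrite eq_le y0 andbT -zy oppr_le0.
  by split=> //; exists 0; rewrite ?oppr0.
Qed.

Section ConvexFunction.
Context {R : realType} {d : nat} (f : 'rV[R]_d -> R).
Hypothesis f_cvx : convex_function setT f.

Lemma convex_function_locally_lipschitz (x : 'rV[R]_d) :
  exists2 C : R, 0 <= C &
    forall u, `|u| * d%:R < 1 -> `|f (x + u) - f x| <= C * `|u|.
Proof.
have fK : cone_convex [set r : R^o | 0 <= r] f.
  move=> a y z a01; rewrite /cone_le/= subr_ge0.
  exact: convex_function_segment.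
have [C C0 Cf] := cone_convex_upper proper_cone_ge0 fK x.
have [D D0 Df] := cone_convex_lower proper_cone_ge0 fK x.
exists (C + D) => [|u u1]; first exact: addr_ge0.
have [b bC] := Cf _ u1; have [c cD] := Df _ u1.
rewrite /cone_le/= !subr_ge0 => fc fb.
rewrite mulrDl ler_norml.
have := mulr_ge0 C0 (normr_ge0 u); have := mulr_ge0 D0 (normr_ge0 u).
by move: bC cD; rewrite !ler_norml; lra.
Qed.

Lemma convex_function_continuous : continuous f.
Proof.
move=> x; apply/(@continuous_normP R _ R^o) => e e0.
have [C C0 Cf] := convex_function_locally_lipschitz x.
have C1 : 0 < 1 + C by lra.
have d1 : 0 < d%:R + 1 :> R by rewrite ltr_wpDl.
apply/near_normP; exists (Num.min (e / (1 + C)) ((d%:R + 1)^-1)).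
  by rewrite lt_min divr_gt0// invr_gt0.
move=> z; rewrite lt_min => /andP[xz xz1].
have := Cf (z - x); rewrite subrKC distrC (distrC (f z)) => Cz.
apply: le_lt_trans (Cz _) _.
  apply: (@le_lt_trans _ _ ((d%:R + 1)^-1 * d%:R)).
    by rewrite ler_wpM2r// ltW.
  by rewrite mulrC ltr_pdivrMr ?mul1r ?ltrDl.
apply: (@le_lt_trans _ _ (C * (e / (1 + C)))); first by rewrite ler_wpM2l// ltW.
have e1 : 0 < e / (1 + C) by exact: divr_gt0.
suff : C * (e / (1 + C)) = e - e / (1 + C) by lra.
by field; rewrite gt_eqF.
Qed.

(** Let [f] stay within 1 of [f x] on the ball of radius [r]. From a point [y] at distance less than
    [r / 2], a step of length [r / 2] along either direction of an axis remains in that ball, so [f]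
    grows by less than 2 and each coordinate of a subgradient is at most [4 / r] in absolute
    value. *)
Lemma subdifferential_locally_bounded (x : 'rV[R]_d) :
  exists M : R, \forall y \near x, forall v, subdifferential f y v -> `|v| <= M.
Proof.
have /(@continuous_normP R _ R^o)/(_ 1 ltr01)/near_normP[r r0 fr] :=
  @convex_function_continuous x.
exists (4 / r); apply/near_normP; exists (r / 2); first by rewrite divr_gt0.
move=> y xy v fv.
have r2 : 0 < r / 2 by rewrite divr_gt0.
have fy : `|f x - f y| < 1 by apply: fr; lra.
have key (s : R) i : `|s| = 1 -> s * v 0 i <= 4 / r.
  move=> s1; set z := y + (r / 2 * s) *: delta_mx 0 i.
  have fz : `|f x - f z| < 1.
    apply: fr; rewrite /z opprD addrA.
    apply: le_lt_trans (ler_normB _ _) _; rewrite normrZ normrM s1.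
    rewrite mulr1 ger0_norm ?ltW//.
    suff : `|delta_mx 0 i : 'rV[R]_d| <= 1.
      by move=> /(ler_wpM2l (ltW r2)); lra.
    rewrite [leLHS]/Num.norm/= mx_normrE; apply/bigmax_leP; split=> //= k _.
    by rewrite mxE; case: (_ && _); rewrite /= ?normr1 ?normr0.
  have := fv z; rewrite {1}/z [y + _]addrC addrK dotvZr dotv_deltar => fyz.
  rewrite ler_pdivlMr//; move: fz fy; rewrite !ltr_norml; nra.
rewrite [leLHS]/Num.norm/= mx_normrE; apply/bigmax_leP; split=> /=.
  by rewrite divr_ge0// ltW.
move=> [k i] _ /=; rewrite (ord1 k) ler_norml lerNl.
have := key 1 i; rewrite normr1 mul1r => -> //.
by have := key (-1) i; rewrite normrN normr1 mulN1r => ->.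
Qed.

End ConvexFunction.

(** By K-convexity the difference quotients for steps in []0, 1]] are below [H (x + u) - H x];
    closedness of [K] passes this on to their limit. *)
Lemma cone_convex_diff {R : realType} {Y : normedModType R} (K : set Y)
    {d : nat} (H : 'rV[R]_d -> Y) (x u : 'rV[R]_d) :
  proper_cone K -> cone_convex K H -> differentiable H x ->
  cone_le K (H x + 'd H x u) (H (x + u)).
Proof.
move=> K_proper H_cvx dH.
have Kcl : closed K by case: K_proper.
apply: (closed_normP K).1 => // e e0.
have /cvgrPdist_lt/(_ e e0) : h^-1 *: ((H \o shift x) (h *: u) - H x)
    @[h --> 0^'] --> 'd H x u.
  by rewrite -deriveE//; exact: diff_derivable.
move=> /nbhs_ballP[r /= r0 Hr].
pose t := Num.min (r / 2) 1.
have t0 : 0 < t by rewrite lt_min ltr01 divr_gt0.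
have t1 : t <= 1 by rewrite ge_min lexx orbT.
have tr : t < r by rewrite gt_min; apply/orP; left; lra.
have := Hr t; rewrite -ball_normE/= sub0r normrN gtr0_norm//.
move=> /(_ tr); rewrite gt_eqF// => /(_ isT) Ht.
exists (H (x + u) - H x - t^-1 *: (H (t *: u + x) - H x)).
  have t01 : 0 <= t <= 1 by rewrite ltW.
  have := H_cvx _ (x + u) x t01.
  have -> : t *: (x + u) + (1 - t) *: x = t *: u + x.
    by rewrite scalerDr addrAC -scalerDl subrKC scale1r addrC.
  have /(proper_coneZ K_proper) Kt : 0 <= t^-1 by rewrite invr_ge0 ltW.
  move=> /Kt; congr (K _).
  have -> : t *: H (x + u) + (1 - t) *: H x - H (t *: u + x) =
      t *: (H (x + u) - H x) - (H (t *: u + x) - H x).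
    by rewrite scalerBr scalerBl scale1r opprB !addrA [LHS](ACl (1*3*2*4)).
  by rewrite scalerBr scalerA mulVf ?gt_eqF// scale1r.
by rewrite (opprD (H x)) addrA distrC opprB [X in `|X|]addrC subrKA.
Qed.

(** * Separation and the sum rule *)

Section Separation.
Context {R : realType} {d : nat} (S : set ('rV[R]_d * R)).
Hypothesis S_cvx : forall (a : R) y z r s, 0 <= a <= 1 -> S (y, r) -> S (z, s) ->
  S (a *: y + (1 - a) *: z, a * r + (1 - a) * s).
Hypothesis S_ge0 : forall r, S (0, r) -> 0 <= r.
Hypothesis S_dom : forall z, exists r, S (z, r).

(* One-dimensional extension step of the Hahn-Banach theorem, along the [k]-th
   coordinate axis: the new coordinate of [w] is the supremum [a] below. *)
Lemma separation_step (k : 'I_d) (w : 'rV[R]_d) :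
  (forall z r, S (z, r) -> (forall i : 'I_d, (k <= i)%N -> z 0 i = 0) ->
     dotv w z <= r) ->
  exists w', forall z r, S (z, r) ->
    (forall i : 'I_d, (k < i)%N -> z 0 i = 0) -> dotv w' z <= r.
Proof.
move=> wS; pose e : 'rV[R]_d := delta_mx 0 k.
pose V (z : 'rV[R]_d) := forall i : 'I_d, (k <= i)%N -> z 0 i = 0.
have slopes z1 t1 r1 z2 t2 r2 : V z1 -> V z2 -> 0 < t1 -> 0 < t2 ->
    S (z1 - t1 *: e, r1) -> S (z2 + t2 *: e, r2) ->
    (dotv w z1 - r1) / t1 <= (r2 - dotv w z2) / t2.
  move=> V1 V2 t10 t20 S1 S2.
  have t12 : 0 < t1 + t2 by rewrite addr_gt0.
  (* With this weight the multiples of [e] cancel, so that [wS] applies to the convex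
     combination. *)
  pose a := t2 / (t1 + t2).
  have a0 : 0 <= a by rewrite divr_ge0// ltW.
  have a1 : 1 - a = t1 / (t1 + t2) by rewrite /a; field; rewrite gt_eqF.
  have a01 : 0 <= a <= 1 by rewrite a0 -subr_ge0 a1 divr_ge0// ltW.
  have := S_cvx a01 S1 S2.
  have -> : a *: (z1 - t1 *: e) + (1 - a) *: (z2 + t2 *: e) =
      a *: z1 + (1 - a) *: z2.
    rewrite scalerBr scalerDr !scalerA addrACA.
    have -> : a * t1 = (1 - a) * t2 by rewrite a1 /a mulrAC [RHS]mulrAC (mulrC t1).
    by rewrite addNr addr0.
  move=> /wS; rewrite dotvDr !dotvZr a1 /a => h.
  rewrite ler_pdivrMr// mulrAC ler_pdivlMr//.
  move: h; rewrite ![_ / _ * _]mulrAC -!mulrDl ler_pM2r ?invr_gt0// => h.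
  suff : t2 * dotv w z1 + t1 * dotv w z2 <= t2 * r1 + t1 * r2 by lra.
  by apply: h => i ki; rewrite !mxE V1// V2// !mulr0 addr0.
(* The slopes imposed from below by points with negative [k]-th coordinate. By [slopes] each is at
   most every slope imposed from above; [S_dom] provides one of each kind, so the supremum is
   finite. *)
pose A := [set b : R | exists z t r,
  [/\ V z, 0 < t, S (z - t *: e, r) & b = (dotv w z - r) / t]].
have V0 : V 0 by move=> i _; rewrite mxE.
have [r1 Sr1] := S_dom (0 - 1 *: e); have [r2 Sr2] := S_dom (0 + 1 *: e).
have A0 : A !=set0 by exists ((dotv w 0 - r1) / 1), 0, 1, r1.
have supA z t r : V z -> 0 < t -> S (z + t *: e, r) ->
    sup A <= (r - dotv w z) / t.
  move=> Vz t0 Sz; apply: ge_sup => // _ [z1 [t1 [s [V1 t10 S1 ->]]]].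
  exact: slopes.
have ubA z t r : V z -> 0 < t -> S (z - t *: e, r) ->
    (dotv w z - r) / t <= sup A.
  move=> Vz t0 Sz; apply: ub_le_sup; last by exists z, t, r.
  exists ((r2 - dotv w 0) / 1) => _ [z1 [t1 [s [V1 t10 S1 ->]]]].
  exact: slopes.
exists (w + (sup A - w 0 k) *: e) => z r Szr Vz.
pose t := z 0 k; pose z0 := z - t *: e.
have Vz0 : V z0.
  move=> i; rewrite leq_eqVlt => /predU1P[/ord_inj <-|ki].
    by rewrite !mxE !eqxx mulr1 subrr.
  by rewrite !mxE Vz// [i == k]gtn_eqF ?andbF ?mulr0 ?subrr.
have -> : dotv (w + (sup A - w 0 k) *: e) z = dotv w z0 + t * sup A.
  rewrite /z0 dotvDl dotvBr dotvZr dotv_deltar dotvC (dotvC (_ *: e)).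
  by rewrite dotvZr dotv_deltar (dotvC z) -/t; ring.
have zE : z = z0 + t *: e by rewrite subrK.
have [t0|t0|t0] := ltrgtP t 0.
- have Nt0 : 0 < - t by rewrite oppr_gt0.
  have := ubA z0 (- t) r Vz0 Nt0; rewrite scaleNr opprK -zE => /(_ Szr).
  by rewrite ler_pdivrMr//; lra.
- have := supA z0 t r Vz0 t0; rewrite -zE => /(_ Szr).
  by rewrite ler_pdivlMr//; lra.
- move: zE; rewrite t0 scale0r addr0 mul0r addr0 => zE.
  by apply: (wS _ _ _ Vz0); rewrite -zE.
Qed.

(** As [S] projects onto the whole space, the separating hyperplane is not vertical: it is the graph
    of a linear form. The induction frees one coordinate at a time, from the zero vector to all of
    the space. *)
Lemma convex_separation : exists w, forall z r, S (z, r) -> dotv w z <= r.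
Proof.
have H n : (n <= d)%N -> exists w, forall z r, S (z, r) ->
    (forall i : 'I_d, (n <= i)%N -> z 0 i = 0) -> dotv w z <= r.
  elim: n => [_|n IHn nd].
    exists 0 => z r Sz z0; have z00 : z = 0 by apply/rowP => i; rewrite mxE z0.
    by move: Sz; rewrite z00 dotv0r; exact: S_ge0.
  have [|w wS] := IHn; first exact: ltnW.
  exact: (@separation_step (Ordinal nd) w).
have [//|w wS] := H d; exists w => z r Sz; apply: wS => // i.
by rewrite leqNgt ltn_ord.
Qed.

End Separation.

(** The set [S] is built from perturbations [p.1] of the points of [V], and optimality of [y] says
    that it lies above 0 at the zero perturbation. For the separating [w], the choice [c = y] shows
    that [v + w] is a subgradient of [g], and the perturbations [y - c] show that [- w] is normal to
    [V]. *)
Lemma subdifferential_normal_cone_sum {R : realType} {d : nat}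
    (g : 'rV[R]_d -> R) (V : set 'rV[R]_d) (v y : 'rV[R]_d) :
  convex_function setT g -> convex_set V -> V y ->
  (forall x, V x -> g y - dotv v y <= g x - dotv v x) ->
  [set a + b | a in subdifferential g y & b in normal_cone V y] v.
Proof.
move=> g_cvx V_cvx Vy y_min.
pose S := [set p : 'rV[R]_d * R | exists2 c, V c &
  g (p.1 + c) - g y - dotv v (p.1 + c - y) <= p.2].
have [||z|w wS] := @convex_separation R d S.
- move=> a z1 z2 r1 r2 a01 [c1 /= V1 S1] [c2 /= V2 S2].
  exists (a *: c1 + (1 - a) *: c2) => /=; first exact: convex_set_segment.
  rewrite addrACA -!scalerDr.
  have := convex_function_segment (z1 + c1) (z2 + c2) g_cvx a01.
  rewrite !(dotvBr, dotvDr, dotvZr) in S1 S2 *.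
  case/andP: a01 => a0 a1 gc.
  have a1' : 0 <= 1 - a by lra.
  have := ler_wpM2l a0 S1; have := ler_wpM2l a1' S2.
  by lra.
- move=> r [c /= Vc]; rewrite add0r dotvBr; have := y_min _ Vc; lra.
- by exists (g (z + y) - g y - dotv v (z + y - y)), y.
exists (v + w).
  move=> z; have /wS : S (z - y, g z - g y - dotv v (z - y)).
    by exists y => //=; rewrite subrK.
  by rewrite dotvDl; lra.
exists (- w); last by rewrite addrK.
move=> c Vc; have /wS : S (y - c, 0).
  by exists c => //=; rewrite subrK !subrr dotv0r subrr.
by rewrite dotvNl !dotvBr; lra.
Qed.

(** * Robinson's condition *)

(* Radstrom's cancellation law: with [B] the open ball of radius [rho], the
   inclusion of [B + B] in [A + B] gives that of [B] in [A]. *)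
Lemma ball_cancellation {R : realType} {Y : normedModType R} (A : set Y) (rho : R) :
  closed A -> convex_set A ->
  (forall y, `|y| < 2 * rho -> exists2 a, A a & `|y - a| < rho) ->
  forall y, `|y| < rho -> A y.
Proof.
move=> Acl Acvx Arho y yrho.
have rho0 : 0 < rho by exact: le_lt_trans yrho.
(* Some point of [A] is within [rho / n.+1] of [y]. The scaled error plus [y] has norm below
   [2 * rho], so some [a'] in [A] approximates it; averaging [a'] into [a] with weight [1 / n.+2]
   improves the bound. *)
have step n : exists2 a, A a & `|n.+1%:R *: (y - a)| < rho.
  elim: n => [|n [a Aa ya]].
    have [|a Aa ya] := Arho y; first lra.
    by exists a; rewrite ?scale1r.
  have [|a' Aa' ya'] := Arho (n.+1%:R *: (y - a) + y).
    by apply: le_lt_trans (ler_normD _ _) _; lra.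
  pose t : R := n.+1%:R / n.+2%:R.
  have tE : 1 - t = n.+2%:R^-1.
    rewrite /t -{1}(@mulfV _ n.+2%:R) ?pnatr_eq0// -mulrBl -natrB ?leqnSn//.
    by rewrite subSnn mul1r.
  have t01 : 0 <= t <= 1 by rewrite divr_ge0//= -subr_ge0 tE invr_ge0.
  exists (t *: a + (1 - t) *: a'); first exact: convex_set_segment.
  have -> : n.+2%:R *: (y - (t *: a + (1 - t) *: a')) =
      n.+1%:R *: (y - a) + y - a'.
    rewrite scalerBr scalerDr !scalerA tE mulfV ?pnatr_eq0// scale1r.
    rewrite /t mulrC divfK ?pnatr_eq0// -[n.+2]addn1 natrD scalerDl scale1r.
    by rewrite scalerBr opprD addrA [_ + y - _]addrAC.
  exact: ya'.
apply: (closed_normP A).1 => // e e0.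
have r0 : 0 <= rho / e by rewrite divr_ge0 ?ltW.
have [a Aa] := step (Num.bound (rho / e)).
rewrite normrZ ger0_norm// => ya; exists a => //.
rewrite -(@ltr_pM2l _ (Num.bound (rho / e)).+1%:R) ?ltr0Sn//.
apply: lt_trans ya _; rewrite -ltr_pdivrMr//.
by apply: lt_trans (archi_boundP r0) _; rewrite ltr_nat.
Qed.

(** * Stability of an interior point of the range of a K-convex map *)

Section TruncatedRange.
Context {R : realType} {Y : completeNormedModType R} (K : set Y).
Hypothesis K_proper : proper_cone K.
Context {d : nat} (Q : set 'rV[R]_d).
Hypotheses (Q_closed : closed Q) (Q_cvx : convex_set Q).
Implicit Types F : 'rV[R]_d -> Y.

(** The bound on [x] brings compactness, and keeps the preimages bounded when [F] is perturbed. *)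
Definition truncated_range F (r : R) : set Y :=
  [set y | exists x, [/\ Q x, `|x| <= r & cone_le K (F x) y]].

(** This is the projection of a closed K-epigraph along the compact set [X]: for [y] outside,
    compactness gives one neighbourhood of [y] that works for all points of [X]. *)
Lemma closed_truncated_range F r :
  cone_convex K F -> closed (truncated_range F r).
Proof.
move=> F_cvx; pose X := Q `&` [set x | `|x| <= r].
have Xc : compact X.
  apply: bounded_closed_compact.
    by exists r; split; [exact: num_real|move=> s rs x [_ /= xr]]; lra.
  apply: closedI => //; apply/closed_normP => x approx /=.
  rewrite leNgt; apply/negP => rx.
  have [|z /= zr xz] := approx (`|x| - r); first by rewrite subr_gt0.
  have := ler_normD (x - z) z; rewrite subrK; lra.
rewrite -[truncated_range F r]setCK; apply: open_closedC.
rewrite openE => y nAy; rewrite /interior.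
have : \forall y' \near y, X `<=` (fun x => ~ cone_le K (F x) y').
  have /compact_near_coveringP/(_ Y (nbhs y)) := Xc; apply => x [Qx xr].
  have : open (~` [set p : 'rV[R]_d * Y | cone_le K (F p.1) p.2]).
    by apply: closed_openC; exact: closed_cone_epigraph.
  rewrite openE => /(_ (x, y)); apply => /= Fxy.
  by apply: nAy; exists x.
by apply: filterS => y' Xy' [x [Qx xr Fx]]; exact: (Xy' x).
Qed.

Lemma truncated_range_segment F r s t a y z :
  cone_convex K F -> 0 <= a <= 1 -> r <= t -> s <= t ->
  truncated_range F r y -> truncated_range F s z ->
  truncated_range F t (a *: y + (1 - a) *: z).
Proof.
move=> F_cvx a01 rt st [x [Qx xr Fx]] [x' [Qx' xr' Fx']].
have /andP[a0 a1] := a01; have a1' : 0 <= 1 - a by lra.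
exists (a *: x + (1 - a) *: x'); split; first exact: convex_set_segment.
  apply: le_trans (ler_normD _ _) _; rewrite !normrZ !ger0_norm//.
  have : a * `|x| <= a * t by rewrite ler_wpM2l// (le_trans xr).
  have : (1 - a) * `|x'| <= (1 - a) * t by rewrite ler_wpM2l// (le_trans xr').
  lra.
apply: cone_le_trans (F_cvx _ _ _ a01) _ => //.
by apply: cone_leD => //; exact: cone_leZ.
Qed.

Lemma convex_truncated_range F r :
  cone_convex K F -> convex_set (truncated_range F r).
Proof.
move=> F_cvx y z l; rewrite !inE => Ay Az.
have l01 : 0 <= l%:num <= 1 by rewrite ge0 le1.
exact: (truncated_range_segment F_cvx l01 (lexx r) (lexx r) Ay Az).
Qed.

(* By compactness each [truncated_range F n] is closed, so Baire's theorem
   replaces the Robinson-Ursescu theorem. *)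
Lemma truncated_range_nbhs0 F : cone_convex K F ->
  [set F z + k | z in Q & k in K]° 0 ->
  exists r delta, 0 < delta /\
    forall y, `|y| < delta -> truncated_range F r y.
Proof.
move=> F_cvx /near_normP[eps eps0 Feps].
have rangeP y : `|y| < eps -> exists n : nat, truncated_range F n%:R y.
  move=> ye; have [|z Qz [k Kk <-]] := Feps y; first by rewrite sub0r normrN.
  exists (Num.bound `|z|), z; split=> //; first by rewrite ltW// archi_boundP.
  by rewrite /cone_le addrC addKr.
(* Otherwise the complements of the truncated ranges would be open and dense, and by Baire would
   share a point of the ball of radius [eps], against [rangeP]. *)
have [n [y0 [del del0 Fn]]] : exists n : nat, exists y0, exists2 del : R, 0 < del &
    forall y, `|y0 - y| < del -> truncated_range F n%:R y.
  apply: contrapT => noball.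
  have : forall n : nat, open (~` truncated_range F n%:R) /\
      dense (~` truncated_range F n%:R).
    move=> n; split; first by apply: closed_openC; exact: closed_truncated_range.
    move=> O [y Oy] Oo; apply: contrapT => OF; apply: noball.
    have /near_normP[del del0 yO] : nbhs y O by exact: open_nbhs_nbhs.
    exists n, y, del => // z yz; apply: contrapT => Fz; apply: OF.
    by exists z; split => //; exact: yO.
  move=> /Baire /(_ (ball 0 eps)) [||a [a0 aF]].
  - by exists 0; exact: ballxx.
  - exact: ball_open.
  - have [|m Fm] := rangeP a; last exact: (aF m I).
    by move: a0; rewrite -ball_normE/= sub0r normrN.
(* The point [- (t *: y0)] has norm below [eps], so it lies in some truncated range. Combining it,
   with weight [1 - a], with the ball around [y0] moves the centre to 0. *)
pose t := eps / (2 * (1 + `|y0|)).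
have y1 : 0 < 2 * (1 + `|y0|) by rewrite mulr_gt0// ltr_pwDl.
have t0 : 0 < t by rewrite divr_gt0.
have [|m Fm] := rangeP (- (t *: y0)).
  rewrite normrN normrZ gtr0_norm// /t mulrAC ltr_pdivrMr//.
  rewrite ltr_pM2l//; have := normr_ge0 y0; lra.
pose a := t / (1 + t).
have t1 : 0 < 1 + t by rewrite addr_gt0.
have a0 : 0 < a by rewrite divr_gt0.
have aE : 1 - a = (1 + t)^-1 by rewrite /a; field; rewrite gt_eqF.
have a01 : 0 <= a <= 1 by rewrite ltW//= -subr_ge0 aE invr_ge0 ltW.
exists (Num.max n%:R m%:R), (a * del); split; first exact: mulr_gt0.
move=> y ydel.
have -> : y = a *: (y0 + a^-1 *: y) + (1 - a) *: - (t *: y0).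
  rewrite scalerDr !scalerA mulfV ?gt_eqF// scale1r scalerN scalerA.
  by rewrite aE [_^-1 * t]mulrC -/a addrAC subrr add0r.
apply: (@truncated_range_segment F n%:R m%:R) => //;
  rewrite ?le_max ?lexx ?orbT//; apply: Fn.
rewrite opprD addrA subrr add0r normrN normrZ normfV gtr0_norm//.
by rewrite mulrC ltr_pdivrMr// mulrC.
Qed.

(** If [x] witnesses [y] for [F], it witnesses [y + (F' x - F x)] for [F']. So the range of [F']
    meets every point of the larger ball up to an error below [rho], which the cancellation law
    removes. *)
Lemma truncated_range_perturbation F F' (r rho : R) :
  cone_convex K F' ->
  (forall x, `|x| <= r -> `|F' x - F x| < rho) ->
  (forall y, `|y| < 2 * rho -> truncated_range F r y) ->
  forall y, `|y| < rho -> truncated_range F' r y.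
Proof.
move=> F'_cvx FF' Frho; apply: ball_cancellation.
- exact: closed_truncated_range.
- exact: convex_truncated_range.
move=> y /Frho[x [Qx xr Fx]]; exists (y + (F' x - F x)).
  exists x; split=> //; by rewrite /cone_le addrAC subrKA.
by rewrite opprD addrA subrr add0r normrN FF'.
Qed.

End TruncatedRange.

(** * The linearized constraint and the sets [Omega z] *)

Section Linearization.
Context {R : realType} {d : nat} {Y : completeNormedModType R}.
Context (K : set Y) (G H : 'rV[R]_d -> Y) (Q : set 'rV[R]_d).
Hypotheses (K_proper : proper_cone K) (G_cvx : cone_convex K G)
  (H_cvx : cone_convex K H) (H_C1 : continuously_differentiable H)
  (Q_closed : closed Q) (Q_cvx : convex_set Q).

Definition linearized (z x : 'rV[R]_d) : Y := G x - H z - 'd H z (x - z).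

Lemma cone_convex_linearized z : cone_convex K (linearized z).
Proof.
move=> a x y a01.
have lE w : linearized z w = G w - (H z + 'd H z (w - z)).
  by rewrite /linearized opprD addrA.
rewrite !lE.
have -> : a *: (G x - (H z + 'd H z (x - z))) +
    (1 - a) *: (G y - (H z + 'd H z (y - z))) = a *: G x + (1 - a) *: G y -
    (H z + 'd H z (a *: x + (1 - a) *: y - z)).
  rewrite !scalerBr addrACA -opprD; congr (_ - _).
  rewrite !scalerDr addrACA -scalerDl subrKC scale1r -!linearZ -linearD.
  by rewrite !scalerBr addrACA -opprD -scalerDl subrKC scale1r.
by apply: (cone_leD K_proper (G_cvx _ _ a01)); exact: (cone_lexx K_proper).
Qed.

Lemma near_linearized a (r rho : R) : 0 < rho ->
  \forall z \near a, forall x, `|x| <= r ->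
    `|linearized z x - linearized a x| < rho.
Proof.
move=> rho0; have [dH cH] := H_C1.
(* A bound for [|x - z|] once [|a - z| < 1]; the difference is then split into three terms of size
   at most [rho / 3]. *)
pose M := `|r| + `|a| + 1.
have M0 : 0 < M by rewrite ltr_wpDl// addr_ge0.
have rho3 : 0 < rho / 3 by rewrite divr_gt0.
have /continuous_normP/(_ _ rho3) Ha := differentiable_continuous (dH a).
have /continuous_normP/(_ _ rho3) da := @diff_continuous _ _ _ _ _ (dH a) a.
have dz : \forall z \near a, forall u,
    `|'d H z u - 'd H a u| <= rho / 3 / M * `|u|.
  by apply: cH; rewrite divr_gt0.
have az : \forall z \near a, `|a - z| < 1 by apply/near_normP; exists 1.
near=> z => x xr.
have -> : linearized z x - linearized a x =
    (H a - H z) - ('d H z (x - z) - 'd H a (x - z)) - ('d H a a - 'd H a z).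
  have Dax : 'd H a (x - a) = 'd H a (x - z) - ('d H a a - 'd H a z).
    by rewrite -!raddfB/= opprB subrKA.
  have alg (g ha hz p q s : Y) :
      g - hz - p - (g - ha - (q - s)) = ha - hz - (p - q) - s.
    by rewrite !opprB !addrA [LHS](ACl (6*2*4*3*5*(1*7)))/= subrr addr0.
  exact: etrans (congr1 (fun w => linearized z x - (G x - H a - w)) Dax)
    (alg _ _ _ _ _ _).
apply: le_lt_trans (ler_normB _ _) _.
have : `|H a - H z - ('d H z (x - z) - 'd H a (x - z))| <=
    `|H a - H z| + `|'d H z (x - z) - 'd H a (x - z)| by exact: ler_normB.
have : `|H a - H z| < rho / 3 by near: z.
have : `|'d H a a - 'd H a z| < rho / 3 by near: z.
have : `|'d H z (x - z) - 'd H a (x - z)| <= rho / 3 / M * `|x - z|.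
  by move: (x - z); near: z.
suff : rho / 3 / M * `|x - z| <= rho / 3 by lra.
have xz : `|x - z| <= M.
  rewrite -(subrKA a); apply: le_trans (ler_normD _ _) _.
  have : `|a - z| < 1 by near: z.
  by have := ler_normB x a; have := ler_norm r; rewrite /M; lra.
by rewrite mulrAC ler_pdivrMr// ler_wpM2l// ltW.
Unshelve. all: by end_near.
Qed.

Lemma Omega_self x : feasible K G H Q x -> Omega K G H Q x x.
Proof. by move=> [GH Qx]; split; rewrite // subrr linear0 subr0. Qed.

Lemma Omega_feasible z x : Omega K G H Q z x -> feasible K G H Q x.
Proof.
move=> [Qx Gx]; split=> //.
have [dH _] := H_C1; have := cone_convex_diff (x - z) K_proper H_cvx (dH z).
rewrite subrKC => Hx; rewrite /cone_le sub0r opprB.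
have := proper_coneD K_proper Gx Hx.
by rewrite sub0r -addrA -opprD opprB addrC subrKA.
Qed.

Lemma convex_Omega z : convex_set (Omega K G H Q z).
Proof.
move=> x y l; rewrite !inE => -[Qx Gx] [Qy Gy].
have l01 : 0 <= l%:num <= 1 by rewrite ge0 le1.
split; first exact: (convex_set_segment Q_cvx l01).
apply: cone_le_trans (cone_convex_linearized z _ _ l01) _ => //.
have -> : 0 = l%:num *: 0 + (1 - l%:num) *: 0 :> Y by rewrite !scaler0 addr0.
by apply: cone_leD => //; apply: cone_leZ => //; rewrite subr_ge0.
Qed.

Lemma closed_feasible : closed (feasible K G H Q).
Proof.
have [dH _] := H_C1.
(* As [G] may be discontinuous, the constraint is read as membership of [(x, H x)] in the closed
   K-epigraph of [G]. *)
have -> : feasible K G H Q = Q `&`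
    (fun x => (x, H x)) @^-1` [set p : 'rV[R]_d * Y | cone_le K (G p.1) p.2].
  by apply/seteqP; split=> x; rewrite /feasible /cone_le /= sub0r opprB => -[].
apply: closedI => //.
apply: closed_comp; last exact: closed_cone_epigraph.
move=> x _; apply: continuous_graph.
exact: differentiable_continuous.
Qed.

(* [xi = (1 - t) *: x + t *: y] for a small fixed [t]: as [z] tends to [a], the
   error of relinearization at [x] becomes small with respect to [t], and
   Robinson's condition provides a bounded [y] that compensates for it. *)
Lemma Omega_lower_semicontinuous a x (e : R) : 0 < e ->
  [set G z - H a - 'd H a (z - a) + k | z in Q & k in K]° 0 ->
  Omega K G H Q a x ->
  \forall z \near a, exists2 xi, Omega K G H Q z xi & `|x - xi| < e.
Proof.
move=> e0 robinson [Qx Gx].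
have [r [del [del0 rdel]]] :=
  truncated_range_nbhs0 K_proper Q_closed Q_cvx (cone_convex_linearized a) robinson.
pose rho := del / 2; have rho0 : 0 < rho by rewrite divr_gt0.
pose M := `|x| + `|r| + 1; have M0 : 0 < M by rewrite ltr_wpDl// addr_ge0.
(* As [M] bounds [|x - y|], the new point is within [t * M <= e / 2] of [x]. *)
pose t := Num.min (1 / 2) (e / (2 * M)).
have t0 : 0 < t by rewrite lt_min !divr_gt0// mulr_gt0.
have t1 : t <= 1 / 2 by rewrite ge_min lexx.
have te : t <= e / (2 * M) by rewrite ge_min lexx orbT.
have t01 : 0 <= t <= 1 by apply/andP; lra.
have n1 := @near_linearized a r rho rho0.
have n2 : \forall z \near a, forall y, `|y| <= `|x| ->
    `|linearized z y - linearized a y| < t * rho.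
  by apply: near_linearized; exact: mulr_gt0.
near=> z.
have rrho y : `|y| < rho -> truncated_range K Q (linearized z) r y.
  apply: (truncated_range_perturbation K_proper Q_closed Q_cvx
    (cone_convex_linearized z)).
    by near: z; exact: n1.
  by move=> w; rewrite /rho mulrC divfK//; exact: rdel.
pose E := linearized z x - linearized a x.
have Erho : `|E| < t * rho by apply: (near n2 z).
(* The value at [y] is chosen so that, with weight [t], it cancels the error [E] at [x], of weight
   [1 - t]. *)
have [|y [Qy yr Gy]] := rrho (- ((1 - t) / t *: E)).
  rewrite normrN normrZ ger0_norm ?divr_ge0 ?ltW//; last by lra.
  rewrite mulrAC ltr_pdivrMr// mulrC [rho * t]mulrC.
  have := normr_ge0 E; nra.
exists (t *: y + (1 - t) *: x); last first.
  rewrite (_ : x - _ = t *: (x - y)).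
    rewrite normrZ gtr0_norm//.
    have xy : `|x - y| <= M.
      by rewrite (le_trans (ler_normB _ _))// /M; have := ler_norm r; lra.
    apply: le_lt_trans (ler_pM _ _ te xy) _ => //; first exact: ltW.
    by rewrite invfM mulrA divfK ?gt_eqF//; lra.
  by rewrite scalerBl scale1r scalerBr; rewrite opprD opprB addrCA subrKC addrC.
split; first exact: convex_set_segment.
apply: cone_le_trans (cone_convex_linearized z _ _ t01) _ => //.
have -> : 0 = t *: - ((1 - t) / t *: E) + (1 - t) *: (0 + E).
  rewrite add0r scalerN scalerA mulrC divfK ?gt_eqF//.
  by rewrite addrC subrr.
apply: cone_leD => //; apply: cone_leZ => //; [exact: ltW| lra|].
have -> : linearized z x = linearized a x + E by rewrite subrKC.
by apply: cone_leD => //; exact: (cone_lexx K_proper).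
Unshelve. all: by end_near.
Qed.

End Linearization.

(** * The iteration *)

Section Subgradient.
Context {R : realType} {d : nat}.
Implicit Types (h : 'rV[R]_d -> R) (v u x y : 'rV[R]_d).

Lemma dotv_jointly_continuous v u (e : R) : 0 < e ->
  exists2 del : R, 0 < del & forall v' u',
    `|v - v'| < del -> `|u - u'| < del -> `|dotv v u - dotv v' u'| < e.
Proof.
move=> e0; pose C := (d%:R + 1) * (`|u| + 1 + `|v|).
have C0 : 0 < C by rewrite mulr_gt0// ?ltr_wpDl// ltr_pwDl// ltr_wpDl.
have eC : 0 < e / C by exact: divr_gt0.
exists (Num.min 1 (e / C)); first by rewrite lt_min ltr01.
move=> v' u'; rewrite !lt_min => /andP[_ vv] /andP[uu1 uu].
have -> : dotv v u - dotv v' u' = dotv (v - v') u' + dotv v (u - u').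
  by rewrite dotvBr dotvDl dotvNl; ring.
apply: le_lt_trans (ler_normD _ _) _.
apply: le_lt_trans (lerD (dotv_le _ _) (dotv_le _ _)) _.
have u1 : `|u'| <= `|u| + 1.
  by have := ler_normB u (u - u'); rewrite opprB subrKC; lra.
have : `|v - v'| * `|u'| <= e / C * (`|u| + 1) by rewrite ler_pM// ltW.
have : `|v| * `|u - u'| <= `|v| * (e / C) by rewrite ler_wpM2l// ltW.
move=> h1 h2; have := ler_wpM2l (ler0n R d) (lerD h1 h2).
have : (d%:R + 1) * (`|u| + 1 + `|v|) * (e / C) = e.
  by rewrite mulrC divfK// gt_eqF.
have := mulr_gt0 eC (ltr_pwDl ltr01 (normr_ge0 u)).
have := mulr_ge0 (ltW eC) (normr_ge0 v).
by lra.
Qed.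

(** On the segment from [x] to [y], the subgradient inequality and strong convexity give the claim
    up to the error [mu / 2 * a * N], which vanishes with [a]. *)
Lemma strongly_convex_subdifferential (mu : R) h v x y :
  0 < mu -> strongly_convex mu h -> subdifferential h x v ->
  h x + dotv v (y - x) + mu / 2 * enorm (y - x) ^+ 2 <= h y.
Proof.
move=> mu0 hmu hv; rewrite leNgt; apply/negP => hy.
set N := enorm (y - x) ^+ 2 in hy.
set D := dotv v (y - x) in hy.
have N0 : 0 <= N by exact: sqr_ge0.
pose gap := h x + D + mu / 2 * N - h y.
have gap0 : 0 < gap by rewrite subr_gt0.
have muN : 0 <= mu * N by rewrite mulr_ge0// ltW.
have den0 : 0 < gap + mu * N by rewrite ltr_pwDl.
(* Replaces the limit: [a * mu * N < gap], so the error is below [gap]. *)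
pose a := gap / (gap + mu * N).
have a0 : 0 < a by exact: divr_gt0.
have a1 : a <= 1 by rewrite ler_pdivrMr// mul1r lerDl.
have a01 : 0 <= a <= 1 by rewrite ltW.
have := hmu y x a a01; rewrite -/N.
have := hv (a *: y + (1 - a) *: x).
have -> : a *: y + (1 - a) *: x - x = a *: (y - x).
  by rewrite scalerBl scale1r scalerBr [x - _]addrC addrA addrK.
rewrite dotvZr -/D => h1 h2.
have : a * gap <= a * (mu / 2 * a * N) by rewrite /gap; lra.
rewrite ler_pM2l//.
have aE : a * (gap + mu * N) = gap by rewrite divfK// gt_eqF.
have := mulr_gt0 a0 gap0.
have := mulr_ge0 (ltW a0) muN.
by lra.
Qed.

Lemma bounded_subgradient_cluster h (x v : nat -> 'rV[R]_d) xs :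
  convex_function setT h -> (forall n, subdifferential h (x n) (v n)) ->
  cluster (x @ \oo) xs ->
  exists vs, forall (e : R) N, 0 < e ->
    exists n, [/\ (N <= n)%N, `|xs - x n| < e & `|vs - v n| < e].
Proof.
move=> h_cvx hv xxs; apply: contrapT => novs.
have [M /near_normP[r r0 rM]] := subdifferential_locally_bounded h_cvx xs.
have cM : compact [set w : 'rV[R]_d | `|w| <= M].
  apply: bounded_closed_compact.
    by exists M; split; [exact: num_real|move=> s Ms w /= wM; lra].
  apply/closed_normP => w approx /=; rewrite leNgt; apply/negP => Mw.
  have [|z /= zM wz] := approx (`|w| - M); first by rewrite subr_gt0.
  by have := ler_normD (w - z) z; rewrite subrK; lra.
(* The index [k] measures both how late [n] is and how close [x n] is to [xs]. If no joint cluster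
   point exists, [P k] holds near each [w] for large [k], hence on the whole ball for one [k] by
   compactness; but [v n] lies in the ball for some such [n]. *)
pose P k w := forall n, (k <= n)%N -> `|xs - x n| < k.+1%:R^-1 -> w <> v n.
have : \forall k \near \oo, [set w : 'rV[R]_d | `|w| <= M] `<=` P k.
  have /compact_near_coveringP/(_ nat \oo P) := cM; apply => w _.
  have [e [N [e0 eN]]] : exists (e : R) N, 0 < e /\
      forall n, (N <= n)%N -> `|xs - x n| < e -> e <= `|w - v n|.
    apply: contrapT => no; apply: novs; exists w => e N e0.
    apply: contrapT => non; apply: no; exists e, N; split=> // n Nn xn.
    by rewrite leNgt; apply/negP => wn; apply: non; exists n.
  have we : \forall w' \near w, `|w - w'| < e by apply/near_normP; exists e.
  exists ([set w' | `|w - w'| < e], [set k | (N <= k)%N /\ k.+1%:R^-1 < e]).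
    split; first exact: we.
    near=> k; split; first by near: k; exact: nbhs_infty_ge.
    by near: k; exact: near_infty_natSinv_lt (PosNum e0).
  move=> [w' k] /= [ww' [Nk ke]] n kn xn w'v.
  have := eN n (leq_trans Nk kn) (lt_trans xn ke).
  by rewrite -w'v; lra.
move=> near_P.
have [k [rk Pk]] : exists k : nat, k.+1%:R^-1 < r /\
    [set w : 'rV[R]_d | `|w| <= M] `<=` P k.
  near \oo => k; exists k; split; last by near: k.
  by near: k; exact: near_infty_natSinv_lt (PosNum r0).
have xsk : \forall z \near xs, `|xs - z| < k.+1%:R^-1.
  by apply/near_normP; exists k.+1%:R^-1.
have xk : (x @ \oo) (x @` [set n | (k <= n)%N]).
  by apply: filterS (nbhs_infty_ge k) => n kn; exists n.
have [_ [/= [n kn <-] xn]] := xxs _ _ xk xsk.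
apply: (Pk (v n) _ n) => //=.
by apply: rM (hv n); exact: lt_trans rk.
Unshelve. all: by end_near.
Qed.

End Subgradient.

(** * Descent along a run and criticality of limit points *)

Section DCA.
Context {R : realType} {d : nat} {Y : completeNormedModType R}.
Context (g0 h0 : 'rV[R]_d -> R) (K : set Y) (G H : 'rV[R]_d -> Y)
  (Q : set 'rV[R]_d).
Hypotheses (g0_cvx : convex_function setT g0) (h0_cvx : convex_function setT h0)
  (K_proper : proper_cone K) (G_cvx : cone_convex K G) (H_cvx : cone_convex K H)
  (H_C1 : continuously_differentiable H)
  (Q_closed : closed Q) (Q_cvx : convex_set Q).
Context (x v : nat -> 'rV[R]_d).
Hypothesis x_dca : dca_run g0 h0 K G H Q x v.

Let f0 z := g0 z - h0 z.

Lemma step_performed_generated n :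
  step_performed g0 K G H Q x v n -> generated g0 K G H Q x v n.
Proof. by move=> xn m mn; apply: xn; exact: leq_trans mn (leq_pred _). Qed.

Lemma generated_feasible n :
  generated g0 K G H Q x v n -> feasible K G H Q (x n).
Proof.
case: n => [_|n xn]; first by case: x_dca.
have [_ [On _]] := (x_dca.2 _ xn).
exact: Omega_feasible On.
Qed.

(** Optimality of [x n.+1] against [y], plus the subgradient inequality for [h0] at [x n.+1].
    Descent uses a [y] better than [x n]; criticality of a limit point uses approximations of its
    competitors. *)
Lemma dca_upper_bound n y :
  step_performed g0 K G H Q x v n -> Omega K G H Q (x n) y ->
  f0 (x n.+1) <= g0 y - h0 (x n) - dotv (v n) (y - x n).
Proof.
move=> xn Oy; have [hv [_ /(_ _ Oy)]] := x_dca.2 _ xn.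
have := hv (x n.+1); rewrite /f0 !dotvBr; lra.
Qed.

Lemma dca_step n : step_performed g0 K G H Q x v n ->
  critical g0 h0 K G H Q (x n) /\ terminates_at g0 K G H Q x v n \/
  f0 (x n.+1) < f0 (x n).
Proof.
move=> xn; have [hv [On Omin]] := x_dca.2 _ xn.
have fn := generated_feasible (step_performed_generated xn).
have Oxn := Omega_self fn.
have [stop|go] := pselect (stopping_criterion g0 K G H Q x v n).
  left; split=> //; split=> //; exists (v n); split=> //.
  apply: subdifferential_normal_cone_sum => //; last exact: stop.2.
  exact: convex_Omega.
right; have [y [Oy ylt]] : exists y, Omega K G H Q (x n) y /\
    g0 y - dotv (v n) y < g0 (x n) - dotv (v n) (x n).
  apply: contrapT => no; apply: go; split=> // y Oy.
  by rewrite leNgt; apply/negP => ylt; apply: no; exists y.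
by have := dca_upper_bound xn Oy; rewrite /f0 dotvBr; lra.
Qed.

Lemma dca_strong_descent mu n : 0 < mu -> strongly_convex mu h0 ->
  step_performed g0 K G H Q x v n ->
  f0 (x n.+1) <= f0 (x n) - mu / 2 * enorm (x n.+1 - x n) ^+ 2.
Proof.
move=> mu0 hmu xn; have [hv [_ Omin]] := x_dca.2 _ xn.
have := Omin _ (Omega_self (generated_feasible (step_performed_generated xn))).
have := strongly_convex_subdifferential (x n.+1) mu0 hmu hv.
by rewrite /f0 dotvBr; lra.
Qed.

Hypothesis endless : forall n, ~ terminates_at g0 K G H Q x v n.

Lemma endless_step_performed n : step_performed g0 K G H Q x v n.
Proof.
elim: n => [//|n IHn] m; rewrite ltnS leq_eqVlt => /predU1P[->|]; last exact: IHn.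
by move=> stop; apply: (@endless n).
Qed.

Lemma dca_nonincreasing : nonincreasing_seq (f0 \o x).
Proof.
apply/nonincreasing_seqP => n /=.
by have [[_ /endless]//|/ltW] := dca_step (@endless_step_performed n).
Qed.

Lemma dca_cluster_critical xs : cluster (x @ \oo) xs ->
  [set G z - H xs - 'd H xs (z - xs) + k | z in Q & k in K]° 0 ->
  critical g0 h0 K G H Q xs.
Proof.
move=> xxs robinson; have performed := @endless_step_performed.
have hv n : subdifferential h0 (x n) (v n) := (x_dca.2 _ (performed n)).1.
have [vs vsE] := bounded_subgradient_cluster h0_cvx hv xxs.
have g0_cont z e : 0 < e -> \forall y \near z, `|g0 z - g0 y| < e.
  exact: (@continuous_normP R _ R^o _ _).1 (@convex_function_continuous _ _ _ g0_cvx z) e.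
have h0_cont z e : 0 < e -> \forall y \near z, `|h0 z - h0 y| < e.
  exact: (@continuous_normP R _ R^o _ _).1 (@convex_function_continuous _ _ _ h0_cvx z) e.
have feas : feasible K G H Q xs.
  apply: (closed_normP _).1 (closed_feasible K_proper G_cvx H_C1 Q_closed) _ _.
  move=> e /(vsE _ 0%N)[n [_ xn _]]; exists (x n) => //.
  exact: generated_feasible (step_performed_generated (performed n)).
(* By continuity, the value at a cluster point is a lower bound of the nonincreasing values along
   the run. *)
have f0_xs m : f0 xs <= f0 (x m).
  rewrite leNgt; apply/negP => fm.
  have e0 : 0 < (f0 xs - f0 (x m)) / 2 by rewrite divr_gt0// subr_gt0.
  have /near_normP[r r0 gr] := g0_cont xs _ e0.
  have /near_normP[s s0 hs] := h0_cont xs _ e0.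
  have rs0 : 0 < Num.min r s by rewrite lt_min r0.
  have [n [mn xn _]] := vsE _ m rs0; move: xn; rewrite lt_min => /andP[].
  move=> /gr + /hs; rewrite !ltr_norml.
  by have := dca_nonincreasing mn; rewrite /= /f0; lra.
have hvs : subdifferential h0 xs vs.
  move=> y; rewrite leNgt; apply/negP => hy.
  have e0 : 0 < (h0 xs + dotv vs (y - xs) - h0 y) / 2.
    by rewrite divr_gt0// subr_gt0.
  have [r r0 dr] := dotv_jointly_continuous vs (y - xs) e0.
  have /near_normP[s s0 hs] := h0_cont xs _ e0.
  have rs0 : 0 < Num.min r s by rewrite lt_min r0.
  have [n [_]] := vsE _ 0%N rs0.
  rewrite !lt_min => /andP[xr /hs hn] /andP[vr _].
  have := dr (v n) (y - x n) vr; rewrite opprB addrC subrKA distrC => /(_ xr).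
  have := hv n y; move: hn; rewrite !ltr_norml; lra.
split=> //; exists vs; split=> //.
apply: subdifferential_normal_cone_sum => //.
- exact: convex_Omega.
- exact: Omega_self.
move=> y Oy; rewrite leNgt; apply/negP => gy.
(* Passing from [y], [xs], [vs] to [xi], [x n], [v n] costs three errors, in [g0], [h0] and [dotv],
   each below a quarter of the gap. *)
have e0 : 0 < (g0 xs - dotv vs xs - (g0 y - dotv vs y)) / 4.
  by rewrite divr_gt0// subr_gt0.
have [r r0 dr] := dotv_jointly_continuous vs (y - xs) e0.
have /near_normP[s s0 hs] := h0_cont xs _ e0.
have /near_normP[t t0 gt] := g0_cont y _ e0.
have rt0 : 0 < Num.min (r / 2) t by rewrite lt_min t0 divr_gt0.
have /near_normP[q q0 Oq] := Omega_lower_semicontinuous K_proper G_cvx H_C1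
  Q_closed Q_cvx rt0 robinson Oy.
have rsq0 : 0 < Num.min (r / 2) (Num.min s q) by rewrite !lt_min s0 q0 divr_gt0.
have [n [_]] := vsE _ 0%N rsq0.
rewrite !lt_min => /and3P[xr /hs hn /Oq[xi Oxi yxi]] /and3P[vr _ _].
move: yxi; rewrite lt_min => /andP[yr /gt gxi].
have vr' : `|vs - v n| < r by lra.
have := dr (v n) (xi - x n) vr'.
have -> : y - xs - (xi - x n) = (y - xi) - (xs - x n).
  by rewrite !opprB addrACA [RHS]addrACA; congr (_ + _); rewrite addrC.
have yxr : `|y - xi - (xs - x n)| < r.
  by apply: le_lt_trans (ler_normB _ _) _; lra.
move=> /(_ yxr); have := dca_upper_bound (performed n) Oxi.
have := f0_xs n.+1; move: hn gxi; rewrite /f0 !ltr_norml (dotvBr vs); lra.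
Qed.

End DCA.

Theorem theorem5 (R : realType) (d : nat) (Y : completeNormedModType R)
    (g0 h0 : 'rV[R]_d -> R) (K : set Y) (G H : 'rV[R]_d -> Y)
    (Q : set 'rV[R]_d)
    (g0_ccvx : closed_convex_function g0)
    (h0_ccvx : closed_convex_function h0)
    (K_proper : proper_cone K)
    (G_cvx : cone_convex K G)
    (H_cvx : cone_convex K H)
    (H_C1 : continuously_differentiable H)
    (Q_closed : closed Q)
    (Q_cvx : convex_set Q)
    (f0_bounded : exists c : R, forall x, feasible K G H Q x -> c <= g0 x - h0 x)
    (x v : nat -> 'rV[R]_d)
    (x_dca : dca_run g0 h0 K G H Q x v) :
  [/\ (forall n, step_performed g0 K G H Q x v n -> Omega K G H Q (x n) !=set0) /\
      (forall n, generated g0 K G H Q x v n -> feasible K G H Q (x n)),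
      (forall n, step_performed g0 K G H Q x v n ->
         critical g0 h0 K G H Q (x n) /\ terminates_at g0 K G H Q x v n \/
         g0 (x n.+1) - h0 (x n.+1) < g0 (x n) - h0 (x n)) /\
      ((forall n, ~ terminates_at g0 K G H Q x v n) ->
         cvgn (fun n => g0 (x n) - h0 (x n))),
      (forall mu : R, 0 < mu -> strongly_convex mu h0 ->
         forall n, step_performed g0 K G H Q x v n ->
           g0 (x n.+1) - h0 (x n.+1) <=
             g0 (x n) - h0 (x n) - mu / 2 * enorm (x n.+1 - x n) ^+ 2)
    & (forall n, ~ terminates_at g0 K G H Q x v n) ->
      forall xs : 'rV[R]_d, cluster (x @ \oo) xs ->
        [set G z - H xs - 'd H xs (z - xs) + k | z in Q & k in K]° 0 ->
        critical g0 h0 K G H Q xs].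
Proof.
have [g0_cvx _] := g0_ccvx; have [h0_cvx _] := h0_ccvx.
split.
- split=> n xn; last exact: (generated_feasible K_proper H_cvx H_C1 x_dca).
  by exists (x n.+1); have [_ []] := x_dca.2 _ xn.
- have steps := dca_step g0_cvx K_proper G_cvx H_cvx H_C1 Q_cvx x_dca.
  split=> // endless; apply: nonincreasing_is_cvgn.
    exact: (dca_nonincreasing g0_cvx K_proper G_cvx H_cvx H_C1 Q_cvx x_dca).
  have [c fc] := f0_bounded; exists c => _ [n _ <-]; apply: fc.
  apply: (generated_feasible K_proper H_cvx H_C1 x_dca).
  exact/step_performed_generated/endless_step_performed.
- move=> mu mu0 hmu n.
  exact: (dca_strong_descent K_proper H_cvx H_C1 x_dca mu0 hmu).
- move=> endless xs.
  exact: (dca_cluster_critical g0_cvx h0_cvx K_proper G_cvx H_cvx H_C1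
    Q_closed Q_cvx x_dca endless).
Qed.
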